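(* Let $\mathcal H$ be a finite-dimensional real Hilbert space, $h:\mathcal H\to\,]-\infty,+\infty]$ a proper, lower semi-continuous, convex function, $\mathcal A=\partial h$, and $\mathcal Q:\mathcal H\to\mathcal H$ a symmetric positive definite linear operator. Let $\mathcal T:=(\mathcal A+\mathcal Q)^{-1}\mathcal Q$ and $\mathcal R:=\mathcal I-\mathcal T$. Then the following hold. (i) $\mathcal T=\mathcal Q^{-\frac12}\circ\operatorname{prox}_{h\circ\mathcal Q^{-\frac12}}\circ\,\mathcal Q^{\frac12}=\operatorname{prox}_h^{\mathcal Q}$. (ii) $\mathcal R=\mathcal Q^{-\frac12}\circ\operatorname{prox}_{h^*\circ\mathcal Q^{\frac12}}\circ\,\mathcal Q^{\frac12}=\mathcal Q^{-1}\circ\operatorname{prox}_{h^*}^{\mathcal Q^{-1}}\circ\,\mathcal Q$.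
   Context: $\partial h$ is the convex subdifferential and $h^*$ the Fenchel conjugate of $h$. $a=\mathcal Tb$ iff $\mathcal Qb\in\mathcal Aa+\mathcal Qa$. For a symmetric positive definite $\mathcal P$, $\|x\|_{\mathcal P}^2:=\langle\mathcal Px|x\rangle$, and for a proper lower semi-continuous convex $g$, $\operatorname{prox}_g^{\mathcal P}(b):=\arg\min_x\, g(x)+\frac12\|x-b\|_{\mathcal P}^2$; $\operatorname{prox}_g:=\operatorname{prox}_g^{\mathcal I}$, where $\mathcal I$ is the identity. *)

(* Defs.v *)
From HB Require Import structures.
From mathcomp Require Import all_boot all_order all_algebra.
From mathcomp Require Import sesquilinear.
From mathcomp Require Import all_classical all_reals all_analysis.
From mathcomp Require Import ring lra.

Set Implicit Arguments.
Unset Strict Implicit.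
Unset Printing Implicit Defensive.

Import Order.TTheory GRing.Theory Num.Theory.
Import numFieldNormedType.Exports.

Local Open Scope classical_set_scope.
Local Open Scope ring_scope.

(* The alias [hilbert dot] carries the norm sqrt <x|x>, hence the library's
   topology of a normed module; it is convertible to V. *)
Section hilbert_space.
Context {R : realType} {V : vectType R}.

Definition hilbert (dot : {dot V for idfun}) : Type := V.

Variable dot : {dot V for idfun}.

HB.instance Definition _ := Vector.copy (hilbert dot) V.

Definition hnorm (x : V) : R := Num.sqrt (dot x x).

Lemma dotC (x y : V) : dot x y = dot y x.
Proof. by rewrite hermC /= expr0 mul1r. Qed.

Lemma dot0r (x : V) : dot x 0 = 0.
Proof. exact: linear0r. Qed.

Lemma dot_ge0 (x : V) : 0 <= dot x x.
Proof.
have [->|x0] := eqVneq x 0; first by rewrite dot0r.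
exact/ltW/neq0_dnorm_gt0.
Qed.

Lemma dotZl (a : R) (x y : V) : dot (a *: x) y = a * dot x y.
Proof. by rewrite linearZl_LR. Qed.

Lemma dotZr (a : R) (x y : V) : dot x (a *: y) = a * dot x y.
Proof. by rewrite dotC dotZl dotC. Qed.

Lemma dotDl (x y z : V) : dot (x + y) z = dot x z + dot y z.
Proof. by rewrite linearDl. Qed.

Lemma dotDr (x y z : V) : dot x (y + z) = dot x y + dot x z.
Proof. by rewrite linearDr. Qed.

Lemma dot_CauchySchwarz (x y : V) : dot x y ^+ 2 <= dot x x * dot y y.
Proof.
have [->|y0] := eqVneq y 0; first by rewrite !dot0r expr0n mulr0.
have yy := neq0_dnorm_gt0 (s := dot) y y0.
have := dot_ge0 (dot y y *: x + - dot x y *: y).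
rewrite !(dotDl, dotDr, dotZl, dotZr) (dotC y x) => h.
rewrite -subr_ge0 -(pmulr_rge0 _ yy).
by apply: le_trans h _; rewrite le_eqVlt; apply/orP; left; apply/eqP; ring.
Qed.

Let hnormD (x y : hilbert dot) : hnorm (x + y) <= hnorm x + hnorm y.
Proof.
rewrite -(@ler_pXn2r _ 2)// ?nnegrE ?addr_ge0 ?sqrtr_ge0//.
rewrite sqrrD !sqr_sqrtr ?dot_ge0// !(dotDl, dotDr) (dotC y x).
suff : dot x y <= hnorm x * hnorm y by rewrite -mulr_natl; lra.
apply: le_trans (ler_norm _) _.
rewrite -(@ler_pXn2r _ 2)// ?nnegrE ?mulr_ge0 ?sqrtr_ge0//.
by rewrite exprMn !sqr_sqrtr ?dot_ge0// real_normK ?num_real ?dot_CauchySchwarz.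
Qed.

Let hnormZ (a : R) (x : hilbert dot) : hnorm (a *: x) = `|a| * hnorm x.
Proof.
by rewrite /hnorm dotZl dotZr mulrA -expr2 sqrtrM ?sqr_ge0// sqrtr_sqr.
Qed.

Let hnorm0_eq0 (x : hilbert dot) : hnorm x = 0 -> x = 0.
Proof.
move=> /eqP; rewrite sqrtr_eq0 => x0; apply/eqP; apply: contraTT x0 => xn0.
by rewrite -ltNge; apply: neq0_dnorm_gt0.
Qed.

HB.instance Definition _ :=
  @Lmodule_isNormed.Build R (hilbert dot) hnorm hnormD hnormZ hnorm0_eq0.

End hilbert_space.

Section linear_operators.
Context {R : realType} {V : vectType R}.
Variable dot : {dot V for idfun}.
Implicit Types P Q S : 'End(V).

Definition symmetric_op P := forall x y, dot (P x) y = dot x (P y).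

Definition sym_psd P := symmetric_op P /\ forall x, 0 <= dot (P x) x.

Definition sym_pd P := symmetric_op P /\ forall x, x != 0 -> 0 < dot (P x) x.

(* The positive semidefinite square root; it exists and is unique as soon as
   [sym_psd Q], and 0 is only a default value for the other operators. *)
Definition sqrt_op Q : 'End(V) :=
  xget 0 [set S | sym_psd S /\ (S \o S)%VF = Q].

End linear_operators.

Section convex_functions.
Context {R : realType} {V : vectType R}.
Variable dot : {dot V for idfun}.
Implicit Types h g : V -> \bar R.
Local Open Scope ereal_scope.

Definition proper_fun h := (forall x, h x != -oo) /\ exists x, h x != +oo.

Definition convex_efun h := forall (x y : V) (t : R), (0 < t < 1)%R ->
  h (t *: x + (1 - t) *: y)%R <= t%:E * h x + (1 - t)%:E * h y.

Definition lsc h := lower_semicontinuous (h : hilbert dot -> \bar R).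

Definition subdifferential h (x : V) : set V :=
  [set u | forall y, h x + (dot u (y - x))%:E <= h y].

Definition conjugate h (u : V) : \bar R :=
  ereal_sup [set (dot u x)%:E - h x | x in [set: V]].

Definition argmin g : set V := [set x | forall y, g x <= g y].

(* prox_g^P as the set of all minimizers, so that no default value is needed
   when the minimizer is not known to exist or to be unique. *)
Definition prox (P : 'End(V)) g (b : V) : set V :=
  argmin (fun x => g x + (2^-1 * dot (P (x - b)) (x - b))%:E).

End convex_functions.

Section set_valued_operators.
Context {V : zmodType}.
Implicit Types A B : V -> set V.

Definition op_fun (f : V -> V) (x : V) : set V := [set f x].

Definition op_add A B (x : V) : set V := [set u + v | u in A x & v in B x].

Definition op_sub A B (x : V) : set V := [set u - v | u in A x & v in B x].

Definition op_inv A (y : V) : set V := [set x | A x y].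

Definition op_comp A B (x : V) : set V := \bigcup_(y in B x) A y.

Definition single_valued A := forall x, exists! y, A x y.

End set_valued_operators.

(* Main.v *)
(** The point [T b] is characterized by the inclusion [Q (b - a) \in dh(a)],
    which is the optimality condition for minimizing [h + 1/2 |. - b|_Q^2].  A
    minimizer exists because [h], being convex and lower semicontinuous, is
    minorized by [c - L |. - x0|], so that minimizing sequences have a finite
    limit value and are Cauchy by strong convexity.  Conversely a point
    satisfying the inclusion is the only minimizer.

    For the conjugate only the implication [u \in dh(a) -> a \in dh^*(u)] is
    used: it shows that [Q (b - a)] satisfies the optimality condition for
    [h^* + 1/2 |. - Q b|^2] in the norm of [Q^-1], hence is its unique
    minimizer.  The formulas with [Q^(1/2)] follow by a change of variables.
    The square root itself comes from the spectral theorem: a complex eigenvalue of a symmetric operator is real. *)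
Require Import Defs.
From HB Require Import structures.
From mathcomp Require Import all_boot all_order all_algebra.
From mathcomp Require Import sesquilinear spectral complex.
From mathcomp Require Import all_classical all_reals all_analysis.
From mathcomp Require Import ring lra.

Set Implicit Arguments.
Unset Strict Implicit.
Unset Printing Implicit Defensive.

Import Order.TTheory GRing.Theory Num.Theory.
Import numFieldNormedType.Exports.
Import VectorInternalTheory.

Local Open Scope classical_set_scope.
Local Open Scope ring_scope.

(** The matrix of [f] has an eigenvalue [a + i b] over the algebraically closed field [R[i]]; taking
    the real and imaginary parts of the eigenvalue equation for an eigenvector [u + i v] gives the
    two identities. *)
Lemma complex_eigenpair (R : rcfType) (V : vectType R) (f : 'End(V)) :
  (0 < dim V)%N -> exists a b u v,
    [/\ (u != 0) || (v != 0), f u = a *: u - b *: v & f v = b *: u + a *: v].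
Proof.
move=> V0; pose M := map_mx (real_complex R) (f2mx f).
have [c /eigenvalueP[z zM z0]] := eigenvalue_closed M V0.
pose re := map_mx (@complex.Re R) z; pose im := map_mx (@complex.Im R) z.
have fE x : f (r2v x) = r2v (x *m f2mx f).
  by rewrite unlock /= r2vK.
have reM : re *m f2mx f = complex.Re c *: re - complex.Im c *: im.
  apply/rowP => j; have /rowP/(_ j) := zM.
  rewrite !mxE => /(congr1 (@complex.Re R)).
  rewrite raddf_sum /= => E; transitivity (complex.Re (c * z 0 j)); last first.
    by case: (c) (z 0 j) => ? ? [].
  rewrite -E; apply: eq_bigr => i _; rewrite !mxE.
  by case: (z 0 i) => /= p q; rewrite mulr0 subr0.
have imM : im *m f2mx f = complex.Im c *: re + complex.Re c *: im.
  apply/rowP => j; have /rowP/(_ j) := zM.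
  rewrite !mxE => /(congr1 (@complex.Im R)).
  rewrite raddf_sum /= => E; transitivity (complex.Im (c * z 0 j)); last first.
    by case: (c) (z 0 j) => ? ? [] /= *; rewrite addrC.
  rewrite -E; apply: eq_bigr => i _; rewrite !mxE.
  by case: (z 0 i) => /= p q; rewrite mulr0 add0r.
exists (complex.Re c), (complex.Im c), (r2v re), (r2v im).
split; rewrite ?fE ?reM ?imM ?linearB ?linearD /= ?linearZ //.
apply: contraR z0; rewrite negb_or !negbK => /andP[/eqP re0 /eqP im0].
have {}re0 : re = 0 by apply: (can_inj r2vK); rewrite re0 linear0.
have {}im0 : im = 0 by apply: (can_inj r2vK); rewrite im0 linear0.
apply/eqP/rowP => j; apply/eqP; rewrite mxE eq_complex /=.
have /rowP/(_ j) := re0; have /rowP/(_ j) := im0.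
by rewrite !mxE => -> ->; rewrite eqxx.
Qed.

(** * Spectral theorem, square roots and coercivity of symmetric operators *)

Section symmetric_operators.
Context {R : realType} {V : vectType R}.
Variable dot : {dot V for idfun}.
Implicit Types (P Q S : 'End(V)) (U : {vspace V}).

Lemma dotBl (x y z : V) : dot (x - y) z = dot x z - dot y z.
Proof. by rewrite -scaleN1r dotDl dotZl mulN1r. Qed.

Lemma dotBr (x y z : V) : dot x (y - z) = dot x y - dot x z.
Proof. by rewrite dotC dotBl !(dotC dot x). Qed.

Lemma dot_suml (I : Type) (s : seq I) (F : I -> V) y :
  dot (\sum_(i <- s) F i) y = \sum_(i <- s) dot (F i) y.
Proof.
elim/big_rec2: _ => [|i a b _ <-]; last by rewrite dotDl.
by rewrite dotC dot0r.
Qed.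

Lemma dot_eq0 (x : V) : (dot x x == 0) = (x == 0).
Proof.
have [->|x0] := eqVneq x 0; first by rewrite dot0r eqxx.
by rewrite gt_eqF// neq0_dnorm_gt0.
Qed.

(** For a complex eigenpair of the restriction of [P] to [U], comparing [<Pu|v>] with [<u|Pv>] gives
    [b (|u|^2 + |v|^2) = 0]. Hence [b = 0], and whichever of [u], [v] is nonzero is a real
    eigenvector, to be normalized. *)
Lemma symmetric_eigenvector P U : symmetric_op dot P ->
    {in U, forall x, P x \in U} -> (0 < \dim U)%N ->
  exists2 e, e \in U /\ dot e e = 1 & P e = dot (P e) e *: e.
Proof.
move=> Psym PU U0.
suff [e [eU e0 [a Pe]]] : exists e, [/\ e \in U, e != 0 & exists a, P e = a *: e].
  have ee := neq0_dnorm_gt0 (s := dot) e e0.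
  pose k := (Num.sqrt (dot e e))^-1.
  have kk : k * k * dot e e = 1.
    by rewrite -invfM -expr2 sqr_sqrtr ?ltW// mulVf// gt_eqF.
  exists (k *: e); first by rewrite rpredZ// dotZl dotZr mulrA.
  rewrite linearZ /= Pe !dotZl dotZr -/k.
  rewrite [k * _](_ : _ = a * (k * k * dot e e)); last by ring.
  by rewrite kk mulr1 !scalerA mulrC.
(* The restriction of [P] as an endomorphism of [U]; the projection changes nothing because [P] maps
   [U] into itself. *)
pose f := linfun (vsproj U \o P \o vsval : subvs_of U -> subvs_of U).
have fE x : vsval (f x) = P (vsval x).
  by rewrite lfunE /= vsprojK// PU// subvsP.
have vs0 (x : subvs_of U) : (x == 0) = (vsval x == 0) by [].
have [a [b [u [v [uv fu fv]]]]] := complex_eigenpair f U0.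
have {}fu : P (vsval u) = a *: vsval u - b *: vsval v by rewrite -fE fu linearB !linearZ.
have {}fv : P (vsval v) = b *: vsval u + a *: vsval v by rewrite -fE fv linearD !linearZ.
have b0 : b = 0.
  have := Psym (vsval u) (vsval v); rewrite fu fv dotBl dotDr !(dotZl, dotZr) => E.
  have {}E : b * (dot (vsval u) (vsval u) + dot (vsval v) (vsval v)) = 0 by lra.
  move/eqP: E; rewrite mulf_eq0 => /orP[/eqP//|].
  rewrite paddr_eq0 ?dot_ge0// !dot_eq0 => /andP[u0 v0]; move: uv.
  by rewrite !vs0 u0 v0.
move: fu fv; rewrite b0 !scale0r subr0 add0r => fu fv.
case/orP: uv => n0; [exists (vsval u)|exists (vsval v)];
  by rewrite subvsP -vs0; split=> //; exists a.
Qed.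

(** The eigenvalue at the unit vector [e] is written [dot (P e) e], so no separate list of
    eigenvalues is carried along. *)
Definition eigenbasis P U (s : seq V) :=
  [/\ uniq s, {in s &, forall e e', dot e e' = (e == e')%:R},
      {in s, forall e, P e = dot (P e) e *: e} &
      {in U, forall x, x = \sum_(e <- s) dot x e *: e}].

(** Induction on the dimension: by symmetry, the orthogonal complement in [U] of a unit eigenvector
    is again stable under [P]. *)
Lemma spectral_subspace P U : symmetric_op dot P ->
  {in U, forall x, P x \in U} -> exists2 s, eigenbasis P U s & {subset s <= U}.
Proof.
move=> Psym; have [n] := ubnP (\dim U); elim: n U => // n IH U dU PU.
have [U0|] := posnP (\dim U).
  exists [::] => //; split => // x xU; rewrite big_nil; apply/eqP.
  by rewrite -memv0; move/eqP: U0; rewrite dimv_eq0 => /eqP <-.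
move=> /(symmetric_eigenvector Psym PU)[e [eU ee] Pe].
(* The orthogonal complement of [e] in [U]; its dimension is smaller because it misses [e]. *)
pose U' := (U :&: lker (linfun (dot e : V -> R^o)))%VS.
have U'P x : (x \in U') = (x \in U) && (dot e x == 0).
  by rewrite memv_cap memv_ker lfunE.
have [||s [us os es ss] sU] := IH U'.
- rewrite (leq_trans _ (_ : \dim U <= n)%N)// (ltn_leqif (dimv_leqif_sup _)) ?capvSl//.
  by apply/negP => /subvP/(_ _ eU); rewrite U'P ee oner_eq0 andbF.
- move=> x; rewrite !U'P => /andP[xU /eqP ex]; rewrite PU//=.
  by rewrite -Psym Pe dotZl ex mulr0.
have se x : x \in s -> dot e x = 0 by move/sU; rewrite U'P => /andP[_ /eqP].
exists (e :: s); last first.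
  by move=> x; rewrite inE => /orP[/eqP->//|/sU]; rewrite U'P => /andP[].
split.
- by rewrite /= us andbT; apply/negP => /se/eqP; rewrite ee oner_eq0.
- move=> x y; rewrite !inE => /orP[/eqP->|xs] /orP[/eqP->|ys].
  + by rewrite ee eqxx.
  + rewrite se//; case: eqP => // E; move: ys; rewrite -E => /se/eqP.
    by rewrite ee oner_eq0.
  + rewrite dotC se//; case: eqP => // E; move: xs; rewrite E => /se/eqP.
    by rewrite ee oner_eq0.
  + exact: os.
- by move=> x; rewrite inE => /orP[/eqP->//|/es].
- move=> x xU; rewrite big_cons.
  have x'U : x - dot x e *: e \in U'.
    by rewrite U'P rpredB ?rpredZ//= dotBr dotZr ee mulr1 (dotC _ x) subrr.
  rewrite -[LHS](subrK (dot x e *: e)) addrC; congr (_ + _).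
  rewrite {1}(ss _ x'U); apply: eq_big_seq => y ys.
  by rewrite dotBl dotZl se// mulr0 subr0.
Qed.

Lemma spectral_theorem P : symmetric_op dot P -> exists s, eigenbasis P fullv s.
Proof.
move=> Psym; have [|s ? _] := @spectral_subspace P fullv Psym; last by exists s.
by move=> x _; rewrite memvf.
Qed.

Lemma eigenbasis_dot P s x y : eigenbasis P fullv s ->
  dot x y = \sum_(e <- s) dot x e * dot y e.
Proof.
move=> [_ _ _ ss]; rewrite {1}(ss x (memvf _)) dot_suml.
by apply: eq_bigr => e _; rewrite dotZl (dotC _ e).
Qed.

Lemma sqrt_op_exists P : sym_psd dot P ->
  exists S, sym_psd dot S /\ (S \o S)%VF = P.
Proof.
move=> [Psym P0]; have [s sP] := spectral_theorem Psym.
have [us os es ss] := sP.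
(* The square root multiplies each eigenvector by the square root of its eigenvalue. *)
pose l e := Num.sqrt (dot (P e) e).
pose g (x : V) : V := \sum_(e <- s) (l e * dot x e) *: e.
have glin : linear g.
  move=> a x y; rewrite /g scaler_sumr -big_split /=; apply: eq_bigr => e _.
  by rewrite scalerA -scalerDl dotDl dotZl; congr (_ *: _); ring.
pose G := GRing.isLinear.Build R V V *:%R g glin.
pose gl : {linear V -> V} := HB.pack g G.
pose S : 'End(V) := linfun gl.
have SE x : S x = g x by rewrite lfunE.
have gE x y : dot (g x) y = \sum_(e <- s) l e * dot x e * dot y e.
  by rewrite dot_suml; apply: eq_bigr => e _; rewrite dotZl (dotC _ e).
exists S; split; first split.
- by move=> x y; rewrite !SE [RHS]dotC !gE; apply: eq_bigr => e _; ring.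
- move=> x; rewrite SE gE sumr_ge0// => e _.
  by rewrite -mulrA mulr_ge0 ?sqrtr_ge0// -expr2 sqr_ge0.
- have Se e : e \in s -> S e = l e *: e.
    move=> ei; rewrite SE /g (bigD1_seq e)//= os// eqxx mulr1 big_seq_cond big1 ?addr0//.
    by move=> e' /andP[e's ne]; rewrite os// eq_sym (negPf ne) mulr0 scale0r.
  apply/lfunP => x; rewrite lfunE /= (ss x (memvf _)) !linear_sum; apply: eq_big_seq => e ei.
  have SSe : S (S e) = P e.
    by rewrite (Se e)// linearZ /= (Se e)// scalerA -expr2 sqr_sqrtr// -es.
  by rewrite !linearZ /= SSe.
Qed.

Lemma sqrt_opP P : sym_psd dot P ->
  sym_psd dot (sqrt_op dot P) /\ (sqrt_op dot P \o sqrt_op dot P)%VF = P.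
Proof.
move=> /sqrt_op_exists[S hS].
by have := @xgetPex _ 0 [set S | sym_psd dot S /\ (S \o S)%VF = P] (ex_intro _ S hS).
Qed.

Lemma sym_pd_psd P : sym_pd dot P -> sym_psd dot P.
Proof.
move=> [Ps Pp]; split=> // x; have [->|/Pp/ltW//] := eqVneq x 0.
by rewrite dot0r.
Qed.

(** The constant is the minimum of 1 and the eigenvalues; 1 starts the induction and covers the
    empty basis. *)
Lemma sym_pd_coercive P : sym_pd dot P ->
  exists2 l, 0 < l & forall x, l * dot x x <= dot (P x) x.
Proof.
move=> [Psym P0]; have [s sP] := spectral_theorem Psym.
have [us os es ss] := sP.
have [l l0 ls] : exists2 l, 0 < l & {in s, forall e, l <= dot (P e) e}.
  have : {in s, forall e, 0 < dot (P e) e}.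
    by move=> e ei; apply: P0; rewrite -dot_eq0 os// eqxx oner_neq0.
  elim: (s) => [|e t IH] st; first by exists 1.
  have [i it|l l0 lt] := IH; first by rewrite st// inE it orbT.
  exists (Num.min l (dot (P e) e)); first by rewrite lt_min l0 st// mem_head.
  move=> i; rewrite inE => /orP[/eqP->|/lt it]; first by rewrite ge_min lexx orbT.
  by rewrite ge_min it.
exists l => // x.
have Pxe e : e \in s -> dot (P x) e = dot (P e) e * dot x e.
  by move=> ei; rewrite Psym {1}(es e ei) dotZr.
rewrite !(eigenbasis_dot _ _ sP) mulr_sumr !big_seq; apply: ler_sum => e ei.
by rewrite Pxe// -mulrA -expr2 ler_wpM2r ?sqr_ge0// ls.
Qed.

Lemma sym_pd_lker P : sym_pd dot P -> lker P == 0%VS.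
Proof.
move=> [_ P0]; apply/lker0P => x y xy; apply/eqP; rewrite -subr_eq0.
by apply: contraT => /P0; rewrite (linearB P) /= xy subrr dotC dot0r ltxx.
Qed.

Lemma sym_pd_inv P : sym_pd dot P -> sym_pd dot (P^-1)%VF.
Proof.
move=> Ppd; have PK := lker0_lfunVK (sym_pd_lker Ppd).
have [Ps P0] := Ppd; split.
  by move=> x y; rewrite -{2}(PK x) Ps PK.
move=> x x0; rewrite -{2}(PK x) dotC; apply: P0.
by apply: contraNneq x0 => E; rewrite -(PK x) E linear0.
Qed.

End symmetric_operators.

(** * Completeness, and a lower bound for convex lower semicontinuous functions *)

Section hilbert_topology.
Context {R : realType} {V : vectType R}.
Variable dot : {dot V for idfun}.

Lemma dot_le_hnorm (x y : V) : `|dot x y| <= hnorm dot x * hnorm dot y.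
Proof.
rewrite -(@ler_pXn2r _ 2)// ?nnegrE ?mulr_ge0 ?sqrtr_ge0//.
by rewrite exprMn !sqr_sqrtr ?dot_ge0// real_normK ?num_real ?dot_CauchySchwarz.
Qed.

Lemma hilbert_cauchy_cvg (x : nat -> hilbert dot) :
  (forall eps : R, 0 < eps -> exists N, forall n, (N <= n)%N ->
     `|x N - x n| < eps) -> cvg (x @ \oo).
Proof.
(* The spectral theorem for the identity supplies an orthonormal basis, which reduces convergence to
   that of real coordinates. *)
move=> xC; have [s [_ _ _ ss]] : exists s, eigenbasis dot \1%VF fullv s.
  by apply: spectral_theorem => u v; rewrite !lfunE.
have cvge e : cvg (dot (x n : V) e @[n --> \oo]).
  apply/cauchy_cvgP/cauchy_exP => eps eps0.
  (* Here [e] is arbitrary, possibly 0; adding 1 keeps the divisor positive. *)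
  have e0 : 0 < hnorm dot e + 1 by rewrite ltr_wpDl// sqrtr_ge0.
  have [N NP] := xC _ (divr_gt0 eps0 e0).
  exists (dot (x N : V) e); exists N => // n /= Nn.
  rewrite /ball/= -dotBl (le_lt_trans (dot_le_hnorm _ _))//.
  have := NP n Nn; rewrite ltr_pdivlMr//; apply: le_lt_trans.
  by rewrite ler_wpM2l ?sqrtr_ge0// lerDl.
pose c e := lim (dot (x n : V) e @[n --> \oo]).
apply/cvg_ex; exists (\sum_(e <- s) c e *: (e : hilbert dot)).
rewrite (_ : x = fun n => \sum_(e <- s) dot (x n : V) e *: (e : hilbert dot)); last first.
  by apply/funext => n; rewrite {1}(ss (x n) (memvf _)).
elim: s {ss} => [|e s IH].
  by rewrite big_nil; under eq_fun do rewrite big_nil; exact: cvg_cst.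
rewrite big_cons; under eq_fun do rewrite big_cons.
by apply: cvgD => //; apply: cvgZr_tmp; exact: cvge.
Qed.

(** Lower semicontinuity bounds [h] below by [r0 - 1] on a ball around [x0]; convexity along
    segments from [x0] turns this into a bound of linear growth outside the ball. *)
Lemma lsc_convex_minorant (h : V -> \bar R) (x0 : V) (r0 : R) :
  lsc dot h -> convex_efun h -> h x0 = r0%:E ->
  exists2 L, 0 <= L & forall y, ((r0 - 1 - L * hnorm dot (y - x0))%:E <= h y)%E.
Proof.
move=> hl hc hx0.
have [|W] := hl x0 (r0 - 1).
  by rewrite hx0 lte_fin ltrBlDr ltrDl.
move=> /nbhs_ballP[d /= d0 dW] WP.
have {W dW}WP y : hnorm dot (y - x0) < d -> ((r0 - 1)%:E < h y)%E.
  move=> yd; apply/WP/dW; rewrite -ball_normE /=.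
  by rewrite distrC.
exists (2 / d) => [|y]; first by rewrite divr_ge0// ltW.
set N := hnorm dot (y - x0); have N0 : 0 <= N by exact: sqrtr_ge0.
have L0 : 0 <= 2 / d * N by rewrite mulr_ge0// divr_ge0// ltW.
have [Nd|dN] := ltP N d.
  by apply: ltW; apply: le_lt_trans (WP _ Nd); rewrite lee_fin gerBl.
have {}N0 : 0 < N by exact: lt_le_trans dN.
(* With this [t], the point [t y + (1 - t) x0] lies at distance [d / 2] from [x0], inside the ball.
   Convexity then gives [h y > r0 - 1 / t], and [1 / t = (2 / d) N]. *)
pose t := d / (2 * N).
have t0 : 0 < t by rewrite divr_gt0// mulr_gt0.
have t1 : t < 1 by rewrite ltr_pdivrMr ?mulr_gt0//; lra.
have := hc y x0 t; rewrite t0 t1 hx0 => /(_ isT).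
have /WP : hnorm dot (t *: y + (1 - t) *: x0 - x0) < d.
  rewrite [X in hnorm _ X](_ : _ = t *: (y - x0)); last first.
    by rewrite scalerBl scale1r scalerBr -addrA addrAC subrr add0r.
  rewrite /hnorm dotZl dotZr mulrA -expr2 sqrtrM ?sqr_ge0// sqrtr_sqr gtr0_norm//.
  rewrite -/(hnorm dot _) -/N /t invfM !mulrA mulfVK ?gt_eqF//; lra.
move=> /lt_le_trans /[apply]; case: (h y) => [r||].
- rewrite -!EFinM -EFinD lte_fin lee_fin => hr.
  have {}hr : - 1 < t * (r - r0) by lra.
  have -> : 2 / d * N = t^-1 by rewrite /t invf_div mulrAC.
  rewrite -(ler_pM2l t0) mulrBr mulfV ?gt_eqF//; nra.
- by rewrite leey.
- by rewrite gt0_muleNy ?lte_fin// addNye.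
Qed.

End hilbert_topology.

(** * Existence, optimality condition and uniqueness for proximal points *)

Section prox.
Context {R : realType} {V : vectType R}.
Variable dot : {dot V for idfun}.
Implicit Types (h g : V -> \bar R) (P Q S : 'End(V)).

Lemma proper_fun_fin h x : proper_fun h -> h x != +oo%E ->
  exists r, h x = r%:E.
Proof. by move=> [/(_ x)]; case: (h x) => // r _ _ _; exists r. Qed.

Lemma sym_quadD Q x y : symmetric_op dot Q ->
  dot (Q (x + y)) (x + y) = dot (Q x) x + 2 * dot (Q x) y + dot (Q y) y.
Proof.
by move=> Qs; rewrite (linearD Q) /= !(dotDl, dotDr) (Qs y x) (dotC _ y (Q x)); ring.
Qed.

Lemma sym_quadZ Q (a : R) x : dot (Q (a *: x)) (a *: x) = a ^+ 2 * dot (Q x) x.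
Proof. by rewrite (linearZZ Q) dotZl dotZr mulrA. Qed.

(** The parallelogram identity for the quadratic form of [Q]; its last term is what makes minimizing
    sequences Cauchy. *)
Lemma sym_quad_midpoint Q x y b : symmetric_op dot Q ->
  dot (Q (2^-1 *: x + (1 - 2^-1) *: y - b)) (2^-1 *: x + (1 - 2^-1) *: y - b) =
  2^-1 * dot (Q (x - b)) (x - b) + 2^-1 * dot (Q (y - b)) (y - b)
    - 4^-1 * dot (Q (x - y)) (x - y).
Proof.
move=> Qs; rewrite (_ : 1 - 2^-1 = 2^-1 :> R); last by lra.
have -> : 2^-1 *: x + 2^-1 *: y - b = 2^-1 *: ((x - b) + (y - b)).
  rewrite addrACA -opprD scalerBr -scalerDr; congr (_ - _).
  by rewrite -mulr2n -[b *+ 2]scaler_nat scalerA mulVf ?scale1r ?pnatr_eq0.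
have -> : x - y = (x - b) + (-1) *: (y - b).
  by rewrite scaleN1r opprB addrA subrK.
move: (x - b) (y - b) => {}x {}y.
by rewrite sym_quadZ !sym_quadD// sym_quadZ dotZr; field.
Qed.

Lemma prox_exists Q h b : proper_fun h -> lsc dot h -> convex_efun h ->
  sym_pd dot Q -> exists a, prox dot Q h b a.
Proof.
move=> hp hl hc Qpd.
have hfin := proper_fun_fin hp; have [_ [x0 hx0]] := hp.
have [l l0 lQ] := sym_pd_coercive Qpd.
have [Qs _] := Qpd; have [_ Q0] := sym_pd_psd Qpd.
pose q x := 2^-1 * dot (Q (x - b)) (x - b).
(* The finite values of the objective, so that its infimum can be taken in [R]. *)
pose E := [set s : R | exists x r, h x = r%:E /\ s = r + q x].
have [r0 hr0] := hfin _ hx0.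
have E0 : has_inf E.
  split; first by exists (r0 + q x0), x0, r0.
  have [L L0 hL] := lsc_convex_minorant hl hc hr0.
  (* The last term is the minimum over [p] of [l / 2 * p ^+ 2 - L * p], attained at [p = L / l]. *)
  exists (r0 - 1 - L * hnorm dot (b - x0) - L ^+ 2 / (2 * l)) => _ [x [r [hr ->]]].
  have := hL x; rewrite hr lee_fin => {}hL.
  set p := hnorm dot (x - b).
  have qp : l / 2 * p ^+ 2 <= q x.
    by rewrite /p /hnorm sqr_sqrtr ?dot_ge0// /q; have := lQ (x - b); lra.
  have xb : L * hnorm dot (x - x0) <= L * (p + hnorm dot (b - x0)).
    rewrite ler_wpM2l//.
    have := @ler_normD _ (hilbert dot) (x - b) (b - x0).
    by rewrite addrA subrK.
  have : 0 <= l / 2 * (p - L / l) ^+ 2 by rewrite mulr_ge0 ?sqr_ge0// divr_ge0 ?ltW.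
  rewrite (_ : l / 2 * _ = l / 2 * p ^+ 2 - L * p + L ^+ 2 / (2 * l)); last first.
    by field; rewrite gt_eqF.
  lra.
set m := inf E.
have mE x r : h x = r%:E -> m <= r + q x.
  by move=> hr; apply: ge_inf; [case: E0|exists x, r].
have /choice[xr xrP] n : exists xr : V * R,
    h xr.1 = xr.2%:E /\ xr.2 + q xr.1 < m + n.+1%:R^-1.
  have [|_ [x [r [hr ->]]] lt] := @inf_adherent _ E n.+1%:R^-1 _ E0.
    by rewrite invr_gt0.
  by exists (x, r).
pose u n : hilbert dot := (xr n).1.
(* The objective at the midpoint is at least [m], and at most the average of the two values minus
   one eighth of the [Q]-form of the difference. Both values are within [n.+1%:R^-1] of [m], and
   coercivity concludes. *)
have um n k : (n <= k)%N -> `|u n - u k| ^+ 2 <= 8 / l * n.+1%:R^-1.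
  move=> nk; have [hn mn] := xrP n; have [hk mk] := xrP k.
  have nk1 : k.+1%:R^-1 <= n.+1%:R^-1 :> R by rewrite lef_pV2 ?posrE// ler_nat.
  have := hc (xr n).1 (xr k).1 2^-1.
  rewrite hn hk -!EFinM -EFinD => /(_ ltac:(lra)) hz.
  have [|w hw] := hfin (2^-1 *: (xr n).1 + (1 - 2^-1) *: (xr k).1).
    by rewrite lt_eqF// (le_lt_trans hz)// ltry.
  move: hz; rewrite hw lee_fin => hz; have := mE _ _ hw.
  rewrite /q sym_quad_midpoint// -!/(q _) => mw.
  have := lQ ((xr n).1 - (xr k).1).
  rewrite -[X in X ^+ 2]/(hnorm dot ((xr n).1 - (xr k).1)).
  rewrite sqr_sqrtr ?dot_ge0// => lq.
  rewrite mulrAC ler_pdivlMr// mulrC; apply: le_trans lq _.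
  move: mn mk mw nk1; rewrite /q.
  by move: (n.+1%:R^-1) (k.+1%:R^-1) => ? ?; lra.
have [x ux] : exists x : V, u @ \oo --> (x : hilbert dot).
  suff /cvg_ex[x ux] : cvg (u @ \oo) by exists x.
  apply: hilbert_cauchy_cvg => e e0.
  have e1 : 0 < e ^+ 2 * l / 8 by rewrite !mulr_gt0// exprn_gt0.
  have [N _ /(_ N (leqnn _)) /= NP] := near_infty_natSinv_lt (PosNum e1).
  exists N => n Nn; rewrite -(@ltr_pXn2r _ 2)// ?nnegrE ?normr_ge0 ?(ltW e0)//.
  apply: le_lt_trans (um _ _ Nn) _.
  by rewrite mulrAC ltr_pdivrMr// mulrC -ltr_pdivlMr.
(* As [h x] is not yet known to be finite, lower semicontinuity is used through reals [a] below it.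
   Eventually [h (u n) > a], while [q (u n)] exceeds [q x - e / 2] up to equality by the tangent
   inequality for [q]; the other [e / 2] absorbs the gap to [m]. *)
have mx a : (a%:E < h x)%E -> a + q x <= m.
  move=> ahx; have [W xW WP] := hl x a ahx.
  apply/ler_addgt0Pr => e e0.
  pose C := hnorm dot (Q (x - b)) + 1.
  have C0 : 0 < C by rewrite ltr_wpDl// sqrtr_ge0.
  have e2 : 0 < e / 2 by lra.
  near \oo => n.
  have un : W (u n) by near: n; exact: ux.
  have nn : n.+1%:R^-1 < e / 2 by near: n; exact: (near_infty_natSinv_lt (PosNum e2)).
  have ud : `|u n - x| < e / 2 / C.
    by near: n; apply: cvgr_distC_lt => //; exact: divr_gt0.
  have [hn mn] := xrP n; have := WP _ un; rewrite hn lte_fin => an.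
  have qn : q x + dot (Q (x - b)) ((xr n).1 - x) <= q (xr n).1.
    have -> : q (xr n).1 = 2^-1 * dot (Q (x - b + ((xr n).1 - x))) (x - b + ((xr n).1 - x)).
      by rewrite (addrC (x - b)) addrA subrK.
    rewrite (sym_quadD (x - b) ((xr n).1 - x) Qs) /q.
    by have := Q0 ((xr n).1 - x); lra.
  have dn : - (e / 2) <= dot (Q (x - b)) ((xr n).1 - x).
    suff : `|dot (Q (x - b)) ((xr n).1 - x)| <= e / 2 by rewrite ler_norml => /andP[].
    apply: le_trans (dot_le_hnorm _ _ _) _; rewrite mulrC.
    move: ud; rewrite ltr_pdivlMr// => /ltW; apply: le_trans.
    by rewrite ler_wpM2l ?sqrtr_ge0 ?lerDl.
  move: mn nn; move: (n.+1%:R^-1) => ?; lra.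
have [r hr] : exists r, h x = r%:E.
  apply: hfin; apply/eqP => hy; have := mx (m - q x + 1).
  by rewrite hy ltry => /(_ isT); lra.
exists x => y; rewrite -!/(q _).
have [->|/hfin[s hs]] := eqVneq (h y) +oo%E; first by rewrite addye ?leey.
rewrite hs hr -!EFinD lee_fin; apply: le_trans (mE _ _ hs).
apply/ler_addgt0Pr => e e0; have := mx (r - e); rewrite hr lte_fin.
by move=> /(_ ltac:(lra)); lra.
Unshelve. all: by end_near. Qed.

(** Minimality of [a] is tested against [a + t (y - a)]; convexity of [h] allows division by [t],
    and the remaining error vanishes as [t] tends to 0. *)
Lemma prox_subdifferential Q h b a : proper_fun h -> convex_efun h ->
  symmetric_op dot Q -> prox dot Q h b a ->
  h a \is a fin_num /\ subdifferential dot h a (Q (b - a)).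
Proof.
move=> hp hc Qs pa.
have hfin := proper_fun_fin hp; have [_ [x0 hx0]] := hp.
have [r hr] : exists r, h a = r%:E.
  apply: proper_fun_fin => //; apply/eqP => ha; have := pa x0.
  by have [s ->] := hfin _ hx0; rewrite ha addye// -EFinD.
split=> [|y]; first by rewrite hr.
have [->|/hfin[s hs]] := eqVneq (h y) +oo%E; first by rewrite leey.
rewrite hs hr -EFinD lee_fin.
set D := dot (Q (y - a)) (y - a).
suff key t : 0 < t < 1 -> r + dot (Q (b - a)) (y - a) <= s + t * (2^-1 * D).
  apply/ler_addgt0Pr => e e0.
  pose K := 2^-1 * `|D| + 1.
  have K0 : 0 < K by rewrite ltr_wpDl// mulr_ge0.
  (* The first bound keeps [t < 1]; the second makes the error [t * (2^-1 * D)] at most [e]. *)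
  pose t := Num.min 2^-1 (e / K).
  have t0 : 0 < t by rewrite lt_min divr_gt0// andbT; lra.
  have t1 : t < 1 by rewrite gt_min; apply/orP; left; lra.
  have te : t * K <= e by rewrite -ler_pdivlMr// ge_min lexx orbT.
  apply: (le_trans (key t _)); first by rewrite t0.
  rewrite lerD2l (le_trans _ te)// ler_wpM2l ?ltW// /K.
  by have := ler_norm D; lra.
move=> /andP[t0 t1]; have := hc y a t; rewrite t0 t1 => /(_ isT).
have := pa (t *: y + (1 - t) *: a).
rewrite hs hr -!EFinM -!EFinD.
have -> : t *: y + (1 - t) *: a - b = (a - b) + t *: (y - a).
  rewrite scalerBl scale1r scalerBr [RHS]addrC -!addrA; congr (_ + _).
  by rewrite addrCA addrA.
rewrite (sym_quadD (a - b) (t *: (y - a)) Qs) sym_quadZ dotZr -/D => le1 le2.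
have [|w hw] := hfin (t *: y + (1 - t) *: a).
  by rewrite lt_eqF// (le_lt_trans le2)// ltry.
move: le1 le2; rewrite hw -EFinD !lee_fin => le1 le2.
rewrite -[b - a]opprB (linearN Q) /= -scaleN1r dotZl -(ler_pM2l t0).
lra.
Qed.

(* The quadratic term is strongly convex, so a point satisfying the first-order
   condition beats every competitor by half its squared distance. *)
Lemma prox_set1 P g b u : sym_pd dot P -> g u \is a fin_num ->
  subdifferential dot g u (P (b - u)) -> prox dot P g b = [set u].
Proof.
move=> Ppd /fineK; set r := fine _ => gu sub.
have [Ps P0] := Ppd; have [_ P0'] := sym_pd_psd Ppd.
have E x : dot (P (x - b)) (x - b) = dot (P (u - b)) (u - b)
    - 2 * dot (P (b - u)) (x - u) + dot (P (x - u)) (x - u).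
  have -> : x - b = (u - b) + (x - u) by rewrite [RHS]addrC addrA subrK.
  rewrite (sym_quadD (u - b) (x - u) Ps) -[b - u]opprB (linearN P) /=.
  by rewrite -[- P _]scaleN1r dotZl; ring.
apply/seteqP; split=> [x /(_ u)|_ -> y].
  apply: contraPP => /eqP xu; apply/negP; rewrite -ltNge.
  have := sub x; rewrite -gu -!EFinD; case: (g x) => [s||]//.
    rewrite -EFinD !(lee_fin, lte_fin) (E x) => rs.
    by have := P0 (x - u); rewrite subr_eq0 => /(_ xu); lra.
  by rewrite addye// ltry.
have := sub y; rewrite -gu -!EFinD; case: (g y) => [s||]//.
  rewrite -EFinD !lee_fin (E y); have := P0' (y - u); lra.
by move=> _; rewrite addye// leey.
Qed.

(** [S] is a bijective isometry from the norm of [dot] to the norm of [P], so substituting [S y] for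
    the variable carries one minimization problem into the other. *)
Lemma prox_pullback P S g c : lker S == 0%VS ->
  (forall x, dot (P (S x)) (S x) = dot x x) ->
  S @` prox dot \1%VF (g \o S) c = prox dot P g (S c).
Proof.
move=> S0 PS; have Sonto z : exists w, z = S w.
  by exists ((S^-1)%VF z); rewrite lker0_lfunVK.
have costE y : (g (S y) + (2^-1 * dot (P (S y - S c)) (S y - S c))%:E =
    (g \o S) y + (2^-1 * dot (\1%VF (y - c)) (y - c))%:E)%E.
  by rewrite -(linearB S) PS id_lfunE.
apply/seteqP; split=> [_ [y py <-] z|x].
  by have [w ->] := Sonto z; rewrite !costE; exact: py.
have [y ->] := Sonto x => py; exists y => // z.
by have := py (S z); rewrite !costE.
Qed.

End prox.

(** * Subgradients of the conjugate *)

Section fenchel.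
Context {R : realType} {V : vectType R}.
Variable dot : {dot V for idfun}.

(** The subgradient inequality says that the supremum defining the conjugate at [u] is attained at
    [a]. At any other [v], the same [a] is a competitor in the supremum, which is the required
    inequality. *)
Lemma subdifferential_conjugate (h : V -> \bar R) a u : h a \is a fin_num ->
  subdifferential dot h a u ->
  conjugate dot h u \is a fin_num /\ subdifferential dot (conjugate dot h) u a.
Proof.
move=> /fineK; set r := fine _ => ha sub.
have hu : conjugate dot h u = (dot u a - r)%:E.
  apply/eqP; rewrite eq_le; apply/andP; split.
    apply: ge_ereal_sup => _ [x _ <-]; have := sub x; rewrite -ha -EFinD.
    case: (h x) => [s||]//=; rewrite -?EFinB ?lee_fin ?dotBr; first by lra.
    by rewrite addeNy leNye.
  by apply: ereal_sup_ubound; exists a => //; rewrite -ha.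
split=> [|v]; first by rewrite hu.
rewrite hu; apply: ereal_sup_ubound; exists a => //; rewrite -ha -EFinB -EFinD.
by congr EFin; rewrite dotBr (dotC _ a v) (dotC _ a u); ring.
Qed.

End fenchel.

(** * Composition of set-valued operators with functions *)

Section set_valued_composition.
Context {V : zmodType}.
Implicit Types (A B : V -> set V) (f : V -> V).

Lemma op_comp_funl f B x : op_comp (op_fun f) B x = f @` B x.
Proof. by rewrite /op_comp /op_fun bigcup_imset1. Qed.

Lemma op_comp_funr A f x : op_comp A (op_fun f) x = A (f x).
Proof. exact: bigcup_set1. Qed.

Lemma op_sub_funl f B x : op_sub (op_fun f) B x = (fun y => f x - y) @` B x.
Proof.
apply/seteqP; split=> [_ [_ -> [y By <-]]|_ [y By <-]]; first by exists y.
by exists (f x) => //; exists y.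
Qed.

End set_valued_composition.

(** * The resolvent as a proximal map *)

Section resolvent.
Context {R : realType} {V : vectType R}.
Variable dot : {dot V for idfun}.

Lemma resolventP (A : V -> set V) (Q : 'End(V)) (b a : V) :
  op_comp (op_inv (op_add A (op_fun Q))) (op_fun Q) b a <-> A a (Q (b - a)).
Proof.
rewrite op_comp_funr /op_inv /op_add (linearB Q) /=; split.
  by move=> [u Au [_ -> E]]; rewrite -[Q b]E addrK.
by move=> Aa; exists (Q b - Q a) => //; exists (Q a) => //; rewrite subrK.
Qed.

(** [subdifferential] does not ask that [a] lie in the domain of [h]; the value [+oo] at [a] would
    force [+oo] at [x0], where [h] is finite. *)
Lemma subdifferential_fin_num (h : V -> \bar R) a u : proper_fun h ->
  subdifferential dot h a u -> h a \is a fin_num.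
Proof.
move=> hp sub; have [hNy [x0 hx0]] := hp; have [r hr] := proper_fun_fin hp hx0.
have := hNy a; have := sub x0; rewrite hr.
by case: (h a) => [s||]//; rewrite addye.
Qed.

Lemma resolvent_set1 (h : V -> \bar R) (Q : 'End(V)) (b : V) :
  proper_fun h -> lsc dot h -> convex_efun h -> sym_pd dot Q ->
  exists a, [/\ subdifferential dot h a (Q (b - a)), prox dot Q h b = [set a] &
    op_comp (op_inv (op_add (subdifferential dot h) (op_fun Q))) (op_fun Q) b
      = [set a]].
Proof.
move=> hp hl hc Qpd; have [a pa] := prox_exists b hp hl hc Qpd.
have [ha sub] := prox_subdifferential hp hc Qpd.1 pa.
have proxE x : subdifferential dot h x (Q (b - x)) -> prox dot Q h b = [set x].
  by move=> s; apply: prox_set1 => //; exact: subdifferential_fin_num s.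
exists a; split=> //; first exact: proxE.
(* Any point of the resolvent is, like [a], the only element of the proximal set, so the two
   coincide. *)
apply/seteqP; split=> [x /resolventP/proxE|_ ->]; last exact/resolventP.
by rewrite (proxE a sub) => ax; have : [set a] a by []; rewrite ax.
Qed.

End resolvent.

Theorem proposition2p4 (R : realType) (H : vectType R)
    (dot : {dot H for idfun}) (h : H -> \bar R) (Q : 'End(H))
    (h_proper : proper_fun h) (h_lsc : lsc dot h) (h_convex : convex_efun h)
    (Q_pd : sym_pd dot Q) :
  let A := subdifferential dot h in
  let T := op_comp (op_inv (op_add A (op_fun Q))) (op_fun Q) in
  let Res := op_sub (op_fun id) T in
  let Qhalf := sqrt_op dot Q in
  let Qmhalf := (Qhalf^-1)%VF in
  single_valued T /\
  (T = op_comp (op_fun Qmhalf)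
         (op_comp (prox dot \1%VF (h \o Qmhalf)) (op_fun Qhalf)) /\
   T = prox dot Q h) /\
  (Res = op_comp (op_fun Qmhalf)
           (op_comp (prox dot \1%VF (conjugate dot h \o Qhalf)) (op_fun Qhalf)) /\
   Res = op_comp (op_fun (Q^-1)%VF)
           (op_comp (prox dot (Q^-1)%VF (conjugate dot h)) (op_fun Q))).
Proof.
move=> A T Res Qhalf Qmhalf.
have TE b := resolvent_set1 b h_proper h_lsc h_convex Q_pd.
have [[Ss _] /lfunP SS] := sqrt_opP (sym_pd_psd Q_pd).
have {}SS x : Qhalf (Qhalf x) = Q x by rewrite -SS comp_lfunE.
have QK := lker0_lfunK (sym_pd_lker Q_pd).
have QVK := lker0_lfunVK (sym_pd_lker Q_pd).
(* [Qhalf] is injective because its square [Q] is. *)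
have S0 : lker Qhalf == 0%VS.
  by apply/lker0P => x y xy; rewrite -(QK x) -(QK y) -!SS xy.
have SK : cancel Qhalf Qmhalf := lker0_lfunK S0.
have SVK : cancel Qmhalf Qhalf := lker0_lfunVK S0.
have SV0 : lker Qmhalf == 0%VS by apply/lker0P; exact: can_inj SVK.
have T_prox : T = prox dot Q h.
  by apply/funext => b; have [a [_ ->]] := TE b.
(* With [u = Q (b - a)] one has [a = Q^-1 (Q b - u)], so [a] being a subgradient of the conjugate at
   [u] is the optimality condition at [Q b] in the norm of [Q^-1]. *)
have prox_conj b a : A a (Q (b - a)) ->
    prox dot (Q^-1)%VF (conjugate dot h) (Q b) = [set Q (b - a)].
  move=> sub; have ha := subdifferential_fin_num h_proper sub.
  have [hu subu] := subdifferential_conjugate ha sub.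
  apply: prox_set1 => //; first exact: sym_pd_inv.
  by rewrite -(linearB Q) QK subKr.
have ResE b : exists2 a, A a (Q (b - a)) & Res b = [set b - a].
  have [a [sub _ Ta]] := TE b; exists a => //.
  by rewrite /Res op_sub_funl /T Ta image_set1.
split; [|split; split=> //].
- by move=> b; have [a [_ _ Ta]] := TE b; exists a; rewrite /T Ta; split.
- rewrite T_prox; apply/funext => b; rewrite op_comp_funl op_comp_funr.
  (* [Qmhalf] is an isometry onto the norm of [Q], and it sends [Qhalf b] to [b]. *)
  rewrite (@prox_pullback _ _ _ Q) ?SK// => x.
  by rewrite -SS SVK Ss SVK.
- apply/funext => b; have [a sub ->] := ResE b.
  rewrite op_comp_funl op_comp_funr.
  have QS x : dot ((Q^-1)%VF (Qhalf x)) (Qhalf x) = dot x x.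
    by rewrite -{1}(SVK x) SS QK -Ss SVK.
  have := prox_pullback (conjugate dot h) (Qhalf b) S0 QS.
  (* The pullback identifies the image under [Qhalf] of the proximal set with the singleton of
     [Q (b - a)]. Applying [Qmhalf] twice leaves [b - a] on one side and a single [Qmhalf] before
     the proximal set on the other. *)
  rewrite SS (prox_conj _ _ sub) => /(congr1 (image^~ (Qmhalf \o Qmhalf))).
  rewrite image_set1 /= -SS !SK -image_comp => <-.
  by congr image; rewrite image_comp; under eq_imagel do rewrite /= SK; rewrite image_id.
- apply/funext => b; have [a sub ->] := ResE b.
  by rewrite op_comp_funl op_comp_funr (prox_conj _ _ sub) image_set1 QK.
Qed.
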